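(* Let $k$ be an algebraically closed field of characteristic zero and let $f(x,y,z,t)\in k[x,y,z,t]$ be a nonsingular quartic form. Then $|\mathrm{Paut}(f)|$ is divisible by $5$ if and only if $f$ is projectively equivalent to $$f^{\lambda,\mu,\xi}=x^3y+y^3z+z^3t+t^3x+\lambda x^2z^2+\mu y^2t^2+\xi xyzt$$ for some $[\lambda,\mu,\xi]\in k^3$.
   Context: A quartic form is a homogeneous polynomial of degree $4$. A nonzero form $f$ in four variables is nonsingular if the projective algebraic set $V_p(f)=\{P\in\mathbf{P}^3(k): f(P)=0\}$ is nonsingular (the partial derivatives of $f$ have no common zero in $k^4\setminus\{0\}$). For $A\in GL_4(k)$, $f_{A^{-1}}$ denotes the form $v\mapsto f(Av)$, and $(A)$ is the class of $A$ in $PGL_4(k)$. For polynomials, $f\sim g$ means $f=cg$ for some $c\in k^*$. $\mathrm{Paut}(f)=\{(A)\in PGL_4(k): f_{A^{-1}}\sim f\}$; it is a finite group when $f$ is nonsingular of degree $\geq 3$. Two forms $f,g$ are projectively equivalent if $f_{T^{-1}}\sim g$ for some $T\in GL_4(k)$. *)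

(* Defs.v *)
From HB Require Import structures.
From mathcomp Require Import all_boot all_order all_algebra.
From mathcomp Require Import classical_sets cardinality.
From mathcomp Require Import mpoly.

Set Implicit Arguments.
Unset Strict Implicit.
Unset Printing Implicit Defensive.

Import GRing.Theory.
Local Open Scope ring_scope.
Local Open Scope quotient_scope.
Local Open Scope classical_set_scope.

(* The library's {'GL_n[R]} is only available over finite rings. *)
Definition GL (k : fieldType) (n : nat) := {A : 'M[k]_n | A \in unitmx}.

Definition scalar_equiv (k : fieldType) (n : nat) : rel (GL k n) :=
  fun A B => is_scalar_mx (invmx (val A) *m val B).

Lemma scalar_equivP (k : fieldType) (n : nat) (A B : GL k n) :
  reflect (exists2 c : k, c != 0 & val B = c *: val A) (scalar_equiv A B).
Proof.
have uA := valP A; have uB := valP B.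
apply: (iffP is_scalar_mxP) => [[c defc] | [c _ ->]]; last first.
  by exists c; rewrite -scalemxAr mulVmx // scalemx1.
have defB : val B = c *: val A.
  by rewrite -(mulKVmx uA (val B)) defc mul_mx_scalar.
have [c0 | c_neq0] := eqVneq c 0; last by exists c.
have M0 (M : 'M[k]_n) : M = 0.
  by rewrite -[M]mulmx1 -(mulmxV uB) [X in X *m invmx _]defB c0 scale0r
             mul0mx mulmx0.
by exists 1; rewrite ?oner_eq0 // (M0 (val B)) (M0 (val A)) scaler0.
Qed.

Lemma scalar_equiv_refl (k : fieldType) (n : nat) (A : GL k n) :
  scalar_equiv A A.
Proof. by apply/scalar_equivP; exists 1; rewrite ?oner_eq0 ?scale1r. Qed.

Lemma scalar_equiv_sym (k : fieldType) (n : nat) (A B : GL k n) :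
  scalar_equiv A B = scalar_equiv B A.
Proof.
suff imp (C D : GL k n) : scalar_equiv C D -> scalar_equiv D C.
  by apply/idP/idP; exact: imp.
case/scalar_equivP=> c c0 defD; apply/scalar_equivP.
by exists c^-1; rewrite ?invr_eq0 // defD scalerA mulVf // scale1r.
Qed.

Lemma scalar_equiv_trans (k : fieldType) (n : nat) (B A C : GL k n) :
  scalar_equiv A B -> scalar_equiv B C -> scalar_equiv A C.
Proof.
case/scalar_equivP=> b b0 defB /scalar_equivP[c c0 defC].
by apply/scalar_equivP; exists (c * b); rewrite ?mulf_neq0 // defC defB scalerA.
Qed.

Canonical scalar_equiv_equiv (k : fieldType) (n : nat) :=
  EquivRel (@scalar_equiv k n) (@scalar_equiv_refl k n)
           (@scalar_equiv_sym k n) (@scalar_equiv_trans k n).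

Definition PGL (k : fieldType) (n : nat) := {eq_quot @scalar_equiv k n}.

Definition PGL_class (k : fieldType) (n : nat) (A : GL k n) : PGL k n :=
  \pi_(PGL k n) A.

(* The form v |-> f(A v), for column vectors v; usually written f_{A^-1}. *)
Definition subst_lin (k : fieldType) (n : nat) (A : 'M[k]_n)
    (f : {mpoly k[n]}) : {mpoly k[n]} :=
  f \mPo [tuple \sum_(j < n) A i j *: 'X_j | i < n].

Definition prop_to (k : fieldType) (n : nat) (f g : {mpoly k[n]}) : Prop :=
  exists2 c : k, c != 0 & f = c *: g.

Definition Paut (k : fieldType) (n : nat) (f : {mpoly k[n]}) : set (PGL k n) :=
  [set PGL_class A | A in [set A : GL k n | prop_to (subst_lin (val A) f) f]].

Definition proj_equiv (k : fieldType) (n : nat) (f g : {mpoly k[n]}) : Prop :=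
  exists T : GL k n, prop_to (subst_lin (val T) f) g.

Definition nonsingular (k : fieldType) (n : nat) (f : {mpoly k[n]}) : Prop :=
  f != 0 /\
  forall v : 'I_n -> k,
    (forall i : 'I_n, (f^`M(i)).@[v] = 0) -> forall i : 'I_n, v i = 0.

Definition quartic5 (k : fieldType) (lambda mu xi : k) : {mpoly k[4]} :=
  let x : {mpoly k[4]} := 'X_(0 : 'I_4) in
  let y : {mpoly k[4]} := 'X_(1 : 'I_4) in
  let z : {mpoly k[4]} := 'X_(2 : 'I_4) in
  let t : {mpoly k[4]} := 'X_(3 : 'I_4) in
  x ^+ 3 * y + y ^+ 3 * z + z ^+ 3 * t + t ^+ 3 * x
  + lambda *: (x ^+ 2 * z ^+ 2) + mu *: (y ^+ 2 * t ^+ 2)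
  + xi *: (x * y * z * t).

(* Main.v *)
(* Let f have degree d + 1 >= 3. If f o A = f and A v = a v (with a transpose), the
   chain rule makes grad f(v), which is nonzero, an eigenvector for a^-d. Hence the
   finite set of eigenvalues of A is stable under a |-> a^-d, and they are roots of
   unity of bounded order e. The unipotent matrix U = A^e also fixes f; comparing
   the growth of grad f(U^n w), of degree d r in n, with that of (grad f(w)) U^-n, of
   degree at most r, forces U = 1. So the stabilizer of f has finite exponent, and is
   finite by the trace argument of Burnside; its image in PGL is Paut f, and 5 divides
   the order iff there is an element of order 5 (Cauchy, Lagrange).

   For a quartic f, such an element lifts to A with f o A = f and A^5 = 1. Its
   eigenvalues are stable under a |-> a^-3 = a^2, so they are z, z^2, z^4, z^8 = z^3 for
   a primitive fifth root of unity z. In a basis of eigenvectors only seven monomials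
   survive, the four x_i^3 x_(i+1) must be present by nonsingularity, and their
   coefficients are normalized to 1 by a diagonal substitution. *)
Require Import Defs.
From HB Require Import structures.
From mathcomp Require Import all_boot all_order all_algebra.
From mathcomp Require Import fingroup cyclic pgroup.
From mathcomp Require Import classical_sets boolp cardinality.
From mathcomp Require Import mpoly ring zify.

Set Implicit Arguments.
Unset Strict Implicit.
Unset Printing Implicit Defensive.

Import GRing.Theory.
Local Open Scope ring_scope.
Local Open Scope classical_set_scope.
Local Open Scope card_scope.

(** * Linear substitutions and gradients *)

(** Identities about substitutions and derivatives only need checking on constants and variables,
    without computing with general monomials. *)
Lemma mpoly_ring_ind (R : comNzRingType) (n : nat) (P : {mpoly R[n]} -> Prop) :
  (forall c, P c%:MP) -> (forall i, P 'X_i) ->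
  (forall p q, P p -> P q -> P (p + q)) ->
  (forall p q, P p -> P q -> P (p * q)) ->
  forall p, P p.
Proof.
move=> PC PX PD PM p; rewrite [p]mpolyE.
elim/big_ind: _ => [||m _] //; first by rewrite -mpolyC0.
rewrite -mul_mpolyC; apply: (PM) => //; rewrite mpolyXE_id.
elim/big_ind: _ => [||i _] //; first by rewrite -mpolyC1.
elim: (m i) => [|a IH]; first by rewrite expr0 -mpolyC1.
by rewrite exprS; apply: PM.
Qed.

Section SubstLin.
Variables (k : fieldType) (n : nat).
Implicit Types (A B : 'M[k]_n) (f g : {mpoly k[n]}) (w : 'rV[k]_n).

Lemma subst_linC A c : subst_lin A c%:MP = c%:MP.
Proof. exact: comp_mpolyC. Qed.

Lemma subst_linX A i : subst_lin A 'X_i = \sum_j A i j *: 'X_j.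
Proof. by rewrite /subst_lin comp_mpolyXU -tnth_nth tnth_mktuple. Qed.

Lemma subst_linD A : {morph subst_lin A : f g / f + g}.
Proof. exact: raddfD. Qed.

Lemma subst_linM A : {morph subst_lin A : f g / f * g}.
Proof. exact: rmorphM. Qed.

Lemma subst_linZ A c f : subst_lin A (c *: f) = c *: subst_lin A f.
Proof. exact: linearZ. Qed.

Lemma subst_lin_sum A I (r : seq I) (F : I -> {mpoly k[n]}) :
  subst_lin A (\sum_(i <- r) F i) = \sum_(i <- r) subst_lin A (F i).
Proof. exact: raddf_sum. Qed.

Lemma subst_lin_comp A B f :
  subst_lin A (subst_lin B f) = subst_lin (B *m A) f.
Proof.
elim/mpoly_ring_ind: f => [c|i|p q IHp IHq|p q IHp IHq].
- by rewrite !subst_linC.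
- rewrite !subst_linX subst_lin_sum.
  under eq_bigr => j _ do rewrite subst_linZ subst_linX scaler_sumr.
  rewrite exchange_big; apply: eq_bigr => j _ /=.
  by rewrite mxE scaler_suml; apply: eq_bigr => l _; rewrite scalerA.
- by rewrite !subst_linD IHp IHq.
- by rewrite !subst_linM IHp IHq.
Qed.

Lemma subst_lin1 f : subst_lin 1%:M f = f.
Proof.
elim/mpoly_ring_ind: f => [c|i|p q IHp IHq|p q IHp IHq].
- by rewrite subst_linC.
- rewrite subst_linX (bigD1 i) //= mxE eqxx scale1r big1 ?addr0 // => j ji.
  by rewrite mxE eq_sym (negbTE ji) scale0r.
- by rewrite subst_linD IHp IHq.
- by rewrite subst_linM IHp IHq.
Qed.

Lemma subst_lin_scale c A d f :
  f \is d.-homog -> subst_lin (c *: A) f = c ^+ d *: subst_lin A f.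
Proof.
move=> /dhomogP hf; rewrite [f]mpolyE !subst_lin_sum scaler_sumr.
apply: eq_big_seq => m /hf md; rewrite !subst_linZ scalerA mulrC -scalerA.
congr (_ *: _); rewrite /subst_lin !comp_mpolyX; have <- : mdeg m = d by [].
rewrite mdegE expr_sum -scaler_prod.
apply: eq_bigr => i _; rewrite !tnth_mktuple -exprZn scaler_sumr.
by congr (_ ^+ _); apply: eq_bigr => j _; rewrite mxE scalerA.
Qed.

(** Points are row vectors, following the row convention of [eigenvalue] and [eigenspace]; hence
    substituting [A] moves points by [A^T]. *)
Definition row_eval f w : k := f.@[fun i => w 0 i].

Lemma row_eval_subst_lin A f w :
  row_eval (subst_lin A f) w = row_eval f (w *m A^T).
Proof.
rewrite /row_eval /subst_lin comp_mpoly_meval; apply: meval_eq => i.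
rewrite tnth_mktuple raddf_sum mxE /=; apply: eq_bigr => j _.
by rewrite mevalZ mevalXU mxE mulrC.
Qed.

Lemma row_evalZ d f c w :
  f \is d.-homog -> row_eval f (c *: w) = c ^+ d * row_eval f w.
Proof.
move=> /dhomogP hf; rewrite /row_eval !mevalE mulr_sumr.
apply: eq_big_seq => m /hf md; rewrite mulrCA; congr (_ * _).
have <- : mdeg m = d by [].
rewrite mdegE expr_sum -big_split; apply: eq_bigr => i _ /=.
by rewrite mxE exprMn.
Qed.

Lemma mderiv_subst_lin A f j :
  (subst_lin A f)^`M(j) = \sum_i A i j *: subst_lin A (f^`M(i)).
Proof.
elim/mpoly_ring_ind: f => [c|i|p q IHp IHq|p q IHp IHq].
- rewrite subst_linC mderivC big1 // => i _.
  by rewrite mderivC -mpolyC0 subst_linC mpolyC0 scaler0.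
- have dX (a b : 'I_n) : ('X_a : {mpoly k[n]})^`M(b) = (a == b)%:R%:MP.
    rewrite mderivX mnm1E; case: eqVneq => [->|]; last by rewrite scale0r mpolyC0.
    by rewrite scale1r -{1}[U_(b)%MM]add0m addmK mpolyX0 mpolyC1.
  rewrite subst_linX raddf_sum /=.
  under eq_bigr => a _ do rewrite mderivZ dX.
  under [RHS]eq_bigr => a _ do rewrite dX subst_linC.
  rewrite (bigD1 j) //= [RHS](bigD1 i) //= !eqxx !big1 ?addr0 //.
    by move=> a /negbTE ai; rewrite eq_sym ai scaler0.
  by move=> a /negbTE ai; rewrite ai scaler0.
- rewrite subst_linD mderivD IHp IHq -big_split; apply: eq_bigr => i _ /=.
  by rewrite mderivD subst_linD scalerDr.
- rewrite subst_linM mderivM IHp IHq mulr_suml mulr_sumr -big_split.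
  apply: eq_bigr => i _ /=.
  by rewrite mderivM subst_linD !subst_linM scalerDr scalerAl scalerAr.
Qed.

Lemma dhomog_mderiv d f i : f \is d.+1.-homog -> f^`M(i) \is d.-homog.
Proof.
move=> /dhomogP hf; apply/dhomogP => m; rewrite mcoeff_msupp mcoeff_mderiv => h.
have /hf : (m + U_(i))%MM \in msupp f.
  by rewrite mcoeff_msupp; apply: contraNneq h => ->; rewrite mul0rn.
by rewrite /= mdegD mdeg1 addn1 => -[].
Qed.

Definition gradient f w : 'rV[k]_n := \row_i row_eval (f^`M(i)) w.

Lemma gradientZ d f c w :
  f \is d.+1.-homog -> gradient f (c *: w) = c ^+ d *: gradient f w.
Proof.
by move=> hf; apply/rowP => i; rewrite !mxE (row_evalZ _ _ (dhomog_mderiv i hf)).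
Qed.

(** The chain rule: while points move by [A^T], gradients are multiplied by [A] itself. This
    opposite behaviour drives both the eigenvalue argument and the growth argument below. *)
Lemma gradient_subst_lin A f w :
  gradient (subst_lin A f) w = gradient f (w *m A^T) *m A.
Proof.
apply/rowP => j; rewrite !mxE mderiv_subst_lin /row_eval raddf_sum /=.
apply: eq_bigr => i _; rewrite mevalZ -/(row_eval _ w) row_eval_subst_lin.
by rewrite mxE mulrC.
Qed.

Lemma gradient_eq0 f w : nonsingular f -> gradient f w = 0 -> w = 0.
Proof.
case=> _ ns /rowP g0; apply/rowP => i; rewrite [RHS]mxE.
by apply: (ns (fun i => w 0 i)) => j; have := g0 j; rewrite !mxE.
Qed.

End SubstLin.

(** * Linear symmetries of a nonsingular form *)

Lemma eigenvalue_trmx (F : fieldType) (n : nat) (A : 'M[F]_n) a :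
  eigenvalue A^T a = eigenvalue A a.
Proof.
by rewrite /eigenvalue /eigenspace !kermx_eq0 !row_free_unit -(tr_scalar_mx n a)
           -raddfB unitmx_tr tr_scalar_mx.
Qed.

Lemma gradient_scale (k : fieldType) (n : nat) (f : {mpoly k[n]}) c w :
  gradient (c *: f) w = c *: gradient f w.
Proof. by apply/rowP => i; rewrite !mxE mderivZ /row_eval mevalZ. Qed.

(* If v A^T = a v, differentiating f o A = c f at v shows that the gradient of f
   at v is a left eigenvector of A. *)
Lemma eigenvalue_gradient (k : fieldType) (n d : nat) (f : {mpoly k[n]})
    (A : 'M[k]_n) c a :
  f \is d.+1.-homog -> nonsingular f -> subst_lin A f = c *: f -> a != 0 ->
  eigenvalue A a -> eigenvalue A (c / a ^+ d).
Proof.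
move=> hf ns fA a0; rewrite -eigenvalue_trmx => /eigenvalueP[v vA v0].
apply/eigenvalueP; exists (gradient f v); last first.
  by apply: contra_neq v0; apply: gradient_eq0.
have := gradient_subst_lin A f v.
rewrite fA vA gradient_scale (gradientZ _ _ hf) -scalemxAl mulrC -scalerA => ->.
by rewrite scalerA mulVf ?scale1r // expf_neq0.
Qed.

Lemma unit_eigenvalue_neq0 (F : fieldType) (n : nat) (A : 'M[F]_n) a :
  A \in unitmx -> eigenvalue A a -> a != 0.
Proof.
move=> uA /eigenvalueP[v vA]; apply: contra_neq => a0.
by rewrite -(mulmxK uA v) vA a0 scale0r mul0mx.
Qed.

(* Eigenvalues are stable under [a |-> (a ^- d) ^- d = a ^+ (d ^ 2)], and there
   are at most n of them. *)
Lemma eigenvalue_root_of_unity (k : fieldType) (n d : nat) (f : {mpoly k[n]})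
    (A : 'M[k]_n) a :
  (1 < d)%N -> f \is d.+1.-homog -> nonsingular f -> A \in unitmx ->
  subst_lin A f = f -> eigenvalue A a -> a ^+ (((d ^ 2) ^ n)`!) = 1.
Proof.
move=> d1 hf ns uA fA Ea; set D := (d ^ 2)%N.
have D1 : (1 < D)%N by rewrite -(ltn_exp2r 1 d (isT : 0 < 2)%N) in d1.
have step b : eigenvalue A b -> eigenvalue A (b ^+ D).
  have fA1 : subst_lin A f = 1 *: f by rewrite scale1r.
  move=> Eb; have b0 := unit_eigenvalue_neq0 uA Eb.
  have := eigenvalue_gradient hf ns fA1 b0 Eb; rewrite mul1r => Eb'.
  have := eigenvalue_gradient hf ns fA1 (unit_eigenvalue_neq0 uA Eb') Eb'.
  by rewrite mul1r exprVn invrK -exprM.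
have iter_step j : eigenvalue A (a ^+ (D ^ j)).
  by elim: j => [|j IH]; rewrite ?expn0 ?expr1 // expnSr exprM step.
have a0 := unit_eigenvalue_neq0 uA Ea.
(* Pigeonhole: these [n.+1] powers are all roots of the characteristic polynomial, which has degree
   [n]. *)
have : ~~ uniq [seq a ^+ (D ^ j) | j <- iota 0 n.+1].
  apply/negP => u; have p0 := monic_neq0 (char_poly_monic A).
  suff /(max_poly_roots p0)/(_ u) : all (root (char_poly A))
      [seq a ^+ (D ^ j) | j <- iota 0 n.+1].
    by rewrite size_map size_iota size_char_poly ltnn.
  by apply/allP => _ /mapP[j _ ->]; rewrite -eigenvalue_root_char.
move/(uniqPn 0) => [i [j]]; rewrite size_map size_iota => -[ij jn].
have iN : (i < n.+1)%N by apply: ltn_trans jn.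
rewrite !(nth_map 0%N) ?size_iota // !nth_iota // !add0n => e.
have lt_D : (D ^ i < D ^ j)%N by rewrite ltn_exp2l.
have E1 : a ^+ (D ^ j - D ^ i) = 1.
  apply: (mulIf (expf_neq0 (D ^ i) a0)).
  by rewrite -exprD subnK ?mul1r ?e // ltnW.
(* The difference is positive and at most [D ^ n], so the factorial is an exponent that depends on
   neither [A] nor [a]. *)
have /dvdnP[q ->] : (D ^ j - D ^ i %| (D ^ n)`!)%N.
  apply: dvdn_fact; rewrite subn_gt0 lt_D /=.
  by apply: leq_trans (leq_subr _ _) _; rewrite leq_exp2l.
by rewrite mulnC exprM E1 expr1n.
Qed.

(** Each linear factor of the characteristic polynomial divides ['X^e - 1], so the whole divides its
    power of exponent [n.+1]; Cayley-Hamilton concludes. *)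
Lemma nilpotent_of_eigenvalues (k : closedFieldType) (n e : nat)
    (A : 'M[k]_n.+1) :
  (forall a, eigenvalue A a -> a ^+ e = 1) -> (A ^+ e - 1) ^+ n.+1 = 0.
Proof.
move=> hA; have [rs Ers] := closed_field_poly_normal (char_poly A).
rewrite (eqP (char_poly_monic A)) scale1r in Ers.
have /dvdpP[q Eq] : char_poly A %| ('X^e - 1) ^+ size rs.
  have : {in rs, forall z, z ^+ e = 1}.
    by move=> z zrs; apply: hA; rewrite eigenvalue_root_char Ers root_prod_XsubC.
  rewrite {}Ers; elim: rs => [|z rs IH] hrs; first by rewrite big_nil dvd1p.
  rewrite big_cons exprS dvdp_mul ?IH //; last first.
    by move=> y yrs; apply: hrs; rewrite inE yrs orbT.
  by rewrite dvdp_XsubCl rootE !hornerE hrs ?subrr ?mem_head.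
have szrs : size rs = n.+1.
  by apply: succn_inj; rewrite -(size_char_poly A) Ers size_prod_XsubC.
have := congr1 (horner_mx A) Eq.
by rewrite szrs rmorphM /= Cayley_Hamilton mulr0 rmorphXn rmorphB /=
           rmorphXn /= horner_mx_X rmorph1.
Qed.

(** In characteristic zero the points 1/(m+1) are pairwise distinct. Agreement there extends to s =
    0, an algebraic substitute for letting m tend to infinity. *)
Lemma poly_eq_at_inverses (k : fieldType) (p q : {poly k}) :
  [pchar k] =i pred0 ->
  (forall m, p.[m.+1%:R^-1] = q.[m.+1%:R^-1]) -> p = q.
Proof.
move=> /pcharf0P ch h; apply/eqP; rewrite -subr_eq0; apply/eqP.
apply: (@roots_geq_poly_eq0 _ _
  [seq m.+1%:R^-1 | m <- iota 0 (size (p - q))]).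
- by apply/allP => _ /mapP[m _ ->]; rewrite rootE !hornerE h subrr.
- rewrite map_inj_uniq ?iota_uniq // => a b /invr_inj/eqP.
  wlog ab : a b / (a <= b)%N => [W|].
    by case/orP: (leq_total a b) => ab; [|rewrite eq_sym => /W->//]; apply: W.
  rewrite eq_sym -subr_eq0 -natrB // ch subSS subn_eq0 => ba.
  by apply/eqP; rewrite eqn_leq ab.
- by rewrite size_map size_iota.
Qed.

(* Up to the factor s ^ r, the entries of w (1 + M) ^ (1 / s) are polynomials
   in s. *)
Lemma unipotent_curve (k : fieldType) (n r : nat) (M : 'M[k]_n.+1)
    (w : 'rV[k]_n.+1) :
  [pchar k] =i pred0 -> M ^+ r.+1 = 0 ->
  exists C : 'I_n.+1 -> {poly k},
    (forall l, (C l).[0] = (r`!%:R^-1 *: (w *m M ^+ r)) 0 l) /\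
    (forall m l, (C l).[m.+1%:R^-1] =
       (m.+1%:R^-1 ^+ r *: (w *m (1 + M) ^+ m.+1)) 0 l).
Proof.
move=> /pcharf0P ch Mr.
(* This is s^r times the binomial coefficient of 1/s over i, a polynomial in s for i <= r. At s = 0
   only the term i = r survives, with value 1/r!. *)
pose c i : {poly k} := i`!%:R^-1%:P * 'X^(r - i) * \prod_(j < i) (1 - j%:R%:P * 'X).
exists (fun l => \sum_(i < r.+1) c i * ((w *m M ^+ i) 0 l)%:P); split=> [l|m l].
  rewrite horner_sum big_ord_recr /= big1 ?add0r; last first.
    move=> i _; rewrite /c !hornerE.
    by rewrite expr0n subn_eq0 leqNgt ltn_ord (mulr0 _) !mul0r.
  rewrite /c subnn !hornerE horner_prod big1 ?mulr1 ?mxE //.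
  by move=> j _; rewrite !hornerE ?mulr0 ?subr0.
have m0 : m.+1%:R != 0 :> k by rewrite ch.
have cE i : (i <= r)%N -> (c i).[m.+1%:R^-1] = m.+1%:R^-1 ^+ r * 'C(m.+1, i)%:R.
  move=> ir; rewrite /c !hornerE horner_prod.
  have -> : \prod_(j < i) (1 - j%:R%:P * 'X).[m.+1%:R^-1] =
            m.+1%:R^-1 ^+ i * (m.+1 ^_ i)%:R :> k.
    elim: i {ir} => [|i IH]; first by rewrite big_ord0 mul1r.
    rewrite big_ord_recr IH /= ffactnSr natrM exprSr !hornerE.
    case: (leqP i m.+1) => im; last first.
      by rewrite ffact_small // mulr0n /=; ring.
    by rewrite natrB //=; move: (m.+1%:R : k) m0 => s s0; field.
  have fi0 : i`!%:R != 0 :> k by rewrite ch -lt0n fact_gt0.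
  rewrite -{2}(subnK ir) exprD -bin_ffact natrM.
  by move: (m.+1%:R : k) m0 => s s0; field.
(* The binomial sum ends at [m.+1], the wanted one at [r]. Both extend by zeros to a common range,
   by nilpotency of [M] and by vanishing of binomial coefficients. *)
have widen a b (F : nat -> 'M[k]_n.+1) : (forall i, (a <= i)%N -> F i = 0) ->
    \sum_(i < a + b) F i = \sum_(i < a) F i.
  move=> F0; rewrite big_split_ord /= [X in _ + X]big1 ?addr0 // => i _.
  by rewrite F0 // leq_addr.
have -> : (1 + M) ^+ m.+1 = \sum_(i < r.+1) M ^+ i *+ 'C(m.+1, i).
  pose F i := M ^+ i *+ 'C(m.+1, i); rewrite -(widen _ m.+2 F) => [|i ri]; last first.
    by rewrite /F -(subnK ri) exprD Mr mulr0 mul0rn.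
  rewrite addnC (widen _ _ F) => [|i mi]; last by rewrite /F bin_small.
  rewrite exprDn_comm; last exact: commr_sym (commr1 _).
  by apply: eq_bigr => i _; rewrite expr1n mul1r.
rewrite horner_sum mulmx_sumr scaler_sumr summxE; apply: eq_bigr => i _.
rewrite hornerM hornerC cE; last by rewrite -ltnS.
rewrite -[M ^+ i *+ _]scaler_nat -scalemxAr scalerA.
by rewrite [in RHS]mxE.
Qed.

(* Comparing the curves w U^(1/s) and (gradient f w) U^(-1/s) at s = 0 shows that
   f is singular at w N^r, the last nonzero power of N = U^T - 1. *)
Lemma unipotent_stabilizer (k : fieldType) (n d : nat) (f : {mpoly k[n.+1]})
    (U : 'M[k]_n.+1) e :
  U \in unitmx -> [pchar k] =i pred0 -> (1 < d)%N -> f \is d.+1.-homog ->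
  nonsingular f -> subst_lin U f = f -> (U - 1) ^+ e = 0 -> U = 1.
Proof.
move=> uU ch d1 hf ns fU Ue; apply/eqP; rewrite -subr_eq0.
apply: contraTT isT => N0.
set N := U - 1 in Ue N0.
have exN : exists e, N ^+ e == 0 by exists e; apply/eqP.
have [[|r] /eqP Nr rmin] := ex_minnP exN.
  by move/eqP: Nr; rewrite expr0 oner_eq0.
have {rmin} Nr0 : N ^+ r != 0.
  by apply/negP => /rmin; rewrite ltnn.
have r0 : (0 < r)%N.
  by rewrite lt0n; apply: contraNneq N0 => r0; rewrite -[N]expr1 -r0 Nr.
have UE : U = 1 + N by rewrite addrC subrK.
pose W := invmx U; pose g w := gradient f w.
(* The inverse of [U] is again 1 plus a matrix whose power [r.+1] vanishes, so [unipotent_curve]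
   also applies to the gradients. *)
have WE : W = 1 + - (N * W).
  by rewrite /N mulrBl mul1r [U * W]mulmxV // opprB addrCA subrr addr0.
have cNW : GRing.comm N W.
  apply: commr_sym; apply: commrB; last exact: commr1.
  by rewrite /GRing.comm [W * U]mulVmx // [U * W]mulmxV.
have NWr : (- (N * W)) ^+ r.+1 = 0.
  by rewrite exprNn exprMn_comm // Nr mul0r mulr0.
have NTX i : N^T ^+ i = (N ^+ i)^T.
  elim: i => [|i IH]; first by rewrite !expr0 trmx1.
  by rewrite exprSr exprS IH; apply/esym/trmx_mul.
have gU w : g (w *m U^T) = g w *m W.
  by rewrite /g -{2}fU gradient_subst_lin mulmxK.
have gUX m w : g (w *m (1 + N^T) ^+ m) = g w *m (1 + - (N * W)) ^+ m.
  rewrite -WE; have -> : 1 + N^T = U^T.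
    by rewrite [in RHS]UE [RHS]raddfD /= [X in _ = X + _]trmx1.
  elim: m w => [|m IH] w; first by rewrite !expr0 !mulmx1.
  by rewrite !exprSr -!mulmxE !mulmxA gU IH.
have NTr : N^T ^+ r.+1 = 0 by rewrite NTX Nr trmx0.
suff Nr_eq0 : N ^+ r = 0 by rewrite Nr_eq0 eqxx in Nr0.
apply: trmx_inj; rewrite trmx0 -NTX; apply/row_matrixP => l.
rewrite row0 rowE; apply: (gradient_eq0 ns); set w := delta_mx 0 l.
have [C [C0 Cm]] := unipotent_curve w ch NTr.
have [G [G0 Gm]] := unipotent_curve (g w) ch NWr.
apply/rowP => i.
(* The partial derivative of [f] along the curve [C], as a polynomial in s. *)
pose P := mmap (@polyC k) C f^`M(i).
have PE s : P.[s] = f^`M(i).@[fun l => (C l).[s]].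
  rewrite /P /mmap mevalE horner_sum; apply: eq_bigr => m _.
  rewrite hornerM hornerC /mmap1 horner_prod; congr (_ * _).
  by apply: eq_bigr => a _; rewrite horner_exp.
(* At s = 1/(m+1), homogeneity of degree [d] gives the left side a factor s^(rd), while [G] absorbs
   only s^r; the quotient is the power of ['X]. *)
have EP : P = 'X^(r * d.-1) * G i.
  apply: (poly_eq_at_inverses ch) => m.
  rewrite PE (meval_eq _ (Cm m)) -/(row_eval _ _) (row_evalZ _ _ (dhomog_mderiv i hf)).
  have := gUX m.+1 w => /rowP/(_ i); rewrite mxE => ->.
  rewrite hornerM hornerXn Gm [in RHS]mxE mulrA -!exprM -exprD.
  by rewrite -mulnSr prednK // ltnW.
have rf0 : r`!%:R != 0 :> k by rewrite (iffLR (pcharf0P _) ch) -lt0n fact_gt0.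
(* At s = 0 the right side vanishes because r(d-1) > 0, and the left side is the partial derivative
   at a nonzero multiple of [w *m N^T ^+ r]. *)
have := congr1 (horner^~ 0) EP.
rewrite PE (meval_eq _ C0) -/(row_eval _ _) (row_evalZ _ _ (dhomog_mderiv i hf)).
rewrite hornerM hornerXn expr0n muln_eq0 -[r == _]negbK -lt0n r0 /=.
rewrite -[d.-1 == _]negbK -lt0n -ltnS prednK ?d1 ?mul0r; last exact: ltnW.
move/eqP; rewrite mulf_eq0 expf_eq0 invr_eq0 (negbTE rf0) andbF /=.
by rewrite !mxE => /eqP.
Qed.

Lemma stabilizer_exponent (k : closedFieldType) (n d : nat)
    (f : {mpoly k[n.+1]}) (A : 'M[k]_n.+1) :
  [pchar k] =i pred0 -> (1 < d)%N -> f \is d.+1.-homog -> nonsingular f ->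
  A \in unitmx -> subst_lin A f = f -> A ^+ (((d ^ 2) ^ n.+1)`!) = 1.
Proof.
move=> ch d1 hf ns uA fA; set e := _`!.
have fAX j : subst_lin (A ^+ j) f = f.
  elim: j => [|j IH]; first exact: subst_lin1.
  by rewrite exprS -mulmxE -subst_lin_comp fA.
apply: (unipotent_stabilizer _ ch d1 hf ns (fAX e) (nilpotent_of_eigenvalues _)).
  exact: (unitrX e (uA : A \is a GRing.unit)).
by move=> a; apply: eigenvalue_root_of_unity uA fA.
Qed.

Lemma eigenvalue_exp (F : fieldType) (n : nat) (A : 'M[F]_n.+1) a e :
  A ^+ e = 1 -> eigenvalue A a -> a ^+ e = 1.
Proof.
move=> Ae /eigenvalueP[v vA v0].
have vAX j : v *m A ^+ j = a ^+ j *: v.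
  elim: j => [|j IH]; first by rewrite expr0 mulmx1 scale1r.
  by rewrite exprSr -mulmxE mulmxA IH -scalemxAl vA scalerA -exprSr.
have : (a ^+ e - 1) *: v = 0 by rewrite scalerBl -vAX Ae mulmx1 scale1r subrr.
by move/eqP; rewrite scaler_eq0 (negbTE v0) orbF subr_eq0 => /eqP.
Qed.

(** * Linear groups of finite exponent *)

Section FiniteExponent.
Variables (k : closedFieldType) (n : nat).
Hypothesis ch : [pchar k] =i pred0.
Implicit Types A B M P : 'M[k]_n.+1.

Definition words (T : Type) (m : nat) (Z : seq T) : seq (seq T) :=
  iter m (fun s => [seq a :: w | a <- Z, w <- s]) [:: [::]].

Lemma mem_words (T : eqType) (Z w : seq T) :
  {subset w <= Z} -> w \in words (size w) Z.
Proof.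
elim: w => [|a w IH] sub /=; first by rewrite inE.
apply: allpairs_f; first by apply: sub; rewrite mem_head.
by apply: IH => b bw; apply: sub; rewrite inE bw orbT.
Qed.

(** The trace is a sum of [n.+1] roots of ['X^e - 1], and only finitely many such sums exist. *)
Lemma finite_order_trace e :
  (0 < e)%N -> exists T : seq k, forall A, A ^+ e = 1 -> \tr A \in T.
Proof.
move=> e0; have [Z EZ] := closed_field_poly_normal ('X^e - 1 : {poly k}).
exists [seq \sum_(z <- w) z | w <- words n.+1 Z] => A Ae.
have [rs Ers] := closed_field_poly_normal (char_poly A).
rewrite (eqP (char_poly_monic A)) scale1r in Ers.
have szrs : size rs = n.+1.
  by apply: succn_inj; rewrite -(size_char_poly A) Ers size_prod_XsubC.
apply/mapP; exists rs; last first.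
  apply: oppr_inj; rewrite -char_poly_trace // Ers.
  by rewrite -szrs coefPn_prod_XsubC // szrs.
rewrite -szrs; apply: mem_words => z zrs.
have Ez : eigenvalue A z.
  by rewrite eigenvalue_root_char Ers root_prod_XsubC.
have : root ('X^e - 1) z.
  by rewrite rootE !hornerE (eigenvalue_exp Ae Ez) subrr.
rewrite EZ rootZ ?root_prod_XsubC // lead_coef_eq0 -size_poly_eq0.
by rewrite size_XnsubC.
Qed.

(** The trace of an idempotent is its rank: the two factors of its rank factorization, multiplied in
    the other order, give an identity matrix. In characteristic zero the rank can be read off from
    the trace. *)
Lemma idempotent_trace0 P : P * P = P -> \tr P = 0 -> P = 0.
Proof.
move=> PP; rewrite -(mulmx_base P) mxtrace_mulC.
have -> : row_base P *m col_base P = 1%:M.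
  apply: (row_free_inj (row_base_free P)); apply: (row_full_inj (col_base_full P)).
  have E := mulmx_base P.
  by rewrite /= mul1mx -mulmxA E mulmxA E; apply: PP.
rewrite mxtrace1 => /eqP; rewrite (iffLR (pcharf0P _) ch) mxrank_eq0 => /eqP P0.
by rewrite mulmx_base.
Qed.

(* The average of the powers of M is a projector of full trace. *)
Lemma finite_order_trace_eq1 e M :
  (0 < e)%N -> M ^+ e = 1 -> (forall j, \tr (M ^+ j) = n.+1%:R) -> M = 1.
Proof.
move=> e0 Me trM; have e0' : e%:R != 0 :> k.
  by rewrite (iffLR (pcharf0P _) ch) -lt0n.
pose P := e%:R^-1 *: \sum_(j < e) M ^+ j.
have MP : M * P = P.
  rewrite /P -scalerAr; congr (_ *: _).
  have := subrX1 M e; rewrite Me subrr mulrBl mul1r => /eqP.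
  by rewrite eq_sym subr_eq0 => /eqP.
have MXP j : M ^+ j * P = P.
  by elim: j => [|j IH]; rewrite ?mul1r // exprSr -mulrA MP.
have PP : P * P = P.
  rewrite {1}/P -scalerAl mulr_suml; under eq_bigr do rewrite MXP.
  by rewrite sumr_const card_ord -scaler_nat scalerA mulVf // scale1r.
have trP : \tr P = n.+1%:R.
  rewrite mxtraceZ raddf_sum /=; under eq_bigr do rewrite trM.
  by rewrite sumr_const card_ord -[_%:R *+ e]mulr_natl mulrA mulVf // mul1r.
have /eqP : 1 - P = 0.
  apply: idempotent_trace0; last by rewrite raddfB /= trP mxtrace1 subrr.
  by rewrite mulrBl mul1r mulrBr mulr1 PP subrr subr0.
by rewrite subr_eq0 => /eqP P1; rewrite -[M]mulr1 {1}P1 MP.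
Qed.

(** Among finite families in [G], one whose span has largest dimension is chosen; adjoining another
    element of [G] cannot enlarge the span. *)
Lemma maximal_span (G : set 'M[k]_n.+1) :
  exists2 s : seq 'M[k]_n.+1, (forall B, B \in s -> G B) &
    forall A, G A -> A \in <<s>>%VS.
Proof.
pose P m := `[< exists2 s : seq 'M[k]_n.+1,
  (forall B, B \in s -> G B) & \dim <<s>> = m >].
have P0 : exists m, P m.
  by exists 0%N; apply/asboolP; exists [::]; rewrite ?span_nil ?dimv0.
have Pmax m : P m -> (m <= \dim {:'M[k]_n.+1})%N.
  by move=> /asboolP[s _ <-]; apply/dimvS/subvf.
have [m /asboolP[s sG sm] mmax] := ex_maxnP P0 Pmax.
exists s => // A GA.
have : P (\dim <<A :: s>>).
  by apply/asboolP; exists (A :: s) => // B; rewrite inE => /predU1P[->|/sG].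
move/mmax; rewrite -sm => le.
have sub : (<<s>> <= <<A :: s>>)%VS by rewrite span_cons addvSr.
have /eqP -> : <<s>>%VS == <<A :: s>>%VS by rewrite eqEdim sub.
by rewrite memv_span ?mem_head.
Qed.

(** Burnside's argument: an element of [G] is determined by the traces of its products with a finite
    family spanning [G], and each trace takes finitely many values. Inverses are powers, by the
    finite exponent. *)
Lemma finite_exponent_finite (G : set 'M[k]_n.+1) e :
  (0 < e)%N -> (forall A B, G A -> G B -> G (A * B)) ->
  (forall A, G A -> A ^+ e = 1) -> finite_set G.
Proof.
move=> e0 GM Ge; have [s sG spanG] := maximal_span G.
have [T hT] := finite_order_trace e0.
pose Phi A := [seq \tr (A * B) | B <- s].
have Phi_inj : {in G &, injective Phi}.
  move=> A B; rewrite !inE => GA GB eqAB.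
  have trAB C : G C -> \tr (A * C) = \tr (B * C).
    move=> /spanG /(@coord_span _ _ _ (in_tuple s)) ->.
    rewrite !mulr_sumr !raddf_sum; apply: eq_bigr => i _ /=.
    rewrite -!scalerAr !mxtraceZ; congr (_ * _).
    have := congr1 (nth 0 ^~ i) eqAB.
    by rewrite /Phi !(nth_map 0).
  have GX C j : G C -> G (C ^+ j).
    move=> GC; have GS i : G (C ^+ i.+1).
      by elim: i => [|i IH]; rewrite ?expr1 // exprS; apply: GM.
    case: j => // ; rewrite expr0 -(Ge C GC) -(prednK e0); exact: GS.
  have BV : B * B ^+ e.-1 = 1 by rewrite -exprS prednK // Ge.
  have VB : B ^+ e.-1 * B = 1 by rewrite -exprSr prednK // Ge.
  pose M := A * B ^+ e.-1.
  have GMM : G M by apply: GM => //; apply: GX.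
  suff M1 : M = 1 by rewrite -[A]mulr1 -VB mulrA -/M M1 mul1r.
  apply: (finite_order_trace_eq1 e0 (Ge _ GMM)).
  elim=> [|j IH]; first by rewrite expr0 mxtrace1.
  (* With B^(e-1) the inverse of B, the trace of A B^-1 M^j equals that of B B^-1 M^j = M^j. *)
  rewrite exprS /M -mulrA trAB; last by apply: GM; apply: GX.
  by rewrite mulrA BV mul1r.
rewrite -(eq_finite_set (inj_card_eq Phi_inj)).
apply: (sub_finite_set _ (finite_seq (words (size s) T))).
move=> _ [A GA <-] /=; rewrite -(size_map (fun B => \tr (A * B))).
apply: mem_words => _ /mapP[B Bs ->]; apply: hT; apply: Ge.
by apply: GM => //; apply: sG.
Qed.

End FiniteExponent.

(** * The projective automorphism group *)

Lemma closed_field_root (k : closedFieldType) (c : k) m :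
  (0 < m)%N -> exists b, b ^+ m = c.
Proof.
move=> m0; have /closed_rootP[b] : size ('X^m - c%:P : {poly k}) != 1%N.
  by rewrite size_XnsubC // eqSS -lt0n.
by rewrite rootE !hornerE subr_eq0 => /eqP; exists b.
Qed.

(** Cauchy's theorem gives one direction and Lagrange's the other, once the given law makes ['I_n] a
    finite group. *)
Lemma prime_dvd_ord_group (n : nat) (mul : 'I_n -> 'I_n -> 'I_n) (one : 'I_n)
    (inv : 'I_n -> 'I_n) (p : nat) :
  associative mul -> left_id one mul -> left_inverse one inv mul -> prime p ->
  (p %| n)%N <-> exists2 x, x <> one & iter p (mul x) one = one.
Proof.
move=> mulA mul1 mulV pr_p.
pose gT : finGroupType := HB.pack 'I_n (Finite_isGroup.Build 'I_n mulA mul1 mulV).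
have iterE (x : gT) m : iter m (mul x) one = (x ^+ m)%g :> gT.
  by elim: m => [|m IH] //=; rewrite IH expgS.
have cardT : #|[set: gT]%SET| = n by rewrite cardsT; apply: card_ord.
split=> [|[x x1 xp]].
  rewrite -{1}cardT => /(Cauchy pr_p)[x _ ox].
  exists x; last by rewrite iterE -ox expg_order.
  by apply/eqP; rewrite -[_ == _]/(x == 1%g) -order_gt1 ox prime_gt1.
have <- : #[x : gT]%g = p.
  by apply: nt_prime_order => //; [rewrite -iterE | apply/eqP].
have := order_dvdG (finset.in_setT (x : gT)); by rewrite cardT.
Qed.

(** The law of the quotient of [S] is transported to ['I_N] through chosen representatives; being
    compatible with [cls], it does not depend on the choice. *)
Lemma prime_dvd_card_image (M Q : Type) (mul : M -> M -> M) (one : M)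
    (inv : M -> M) (cls : M -> Q) (S : set M) (N p : nat) :
  associative mul -> left_id one mul -> left_inverse one inv mul ->
  (forall a a' b b', cls a = cls a' -> cls b = cls b' ->
     cls (mul a b) = cls (mul a' b')) ->
  S one -> (forall a, S a -> S (inv a)) ->
  (forall a b, S a -> S b -> S (mul a b)) ->
  prime p -> [set cls a | a in S] #= `I_N ->
  (p %| N)%N <->
    exists2 a, S a & cls a <> cls one /\ cls (iter p (mul a) one) = cls one.
Proof.
move=> mulA mul1 mulV clsM S1 SV SM pr_p /card_set_bijP[h [hS hinj hsurj]].
(* The image contains [cls one], so [N] is positive; this makes [inord] available. *)
case: N hS hsurj => [|N] hS hsurj.
  by have : (h (cls one) < 0)%N by apply: hS; exists one.
have /choice[rep repP] (i : 'I_N.+1) : exists a, S a /\ h (cls a) = i.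
  by have [_ [a Sa <-] ha] := hsurj i (ltn_ord i); exists a.
pose idx a : 'I_N.+1 := inord (h (cls a)).
have hidx a : S a -> idx a = h (cls a) :> nat.
  by move=> Sa; rewrite inordK //; apply: hS; exists a.
have cls_inj a b : S a -> S b -> h (cls a) = h (cls b) -> cls a = cls b.
  by move=> Sa Sb; apply: hinj; apply/mem_set; [exists a | exists b].
have Srep i : S (rep i) by case: (repP i).
have repK a : S a -> cls (rep (idx a)) = cls a.
  by move=> Sa; apply: cls_inj => //; rewrite (proj2 (repP _)) hidx.
have idxK i : idx (rep i) = i by apply: val_inj; rewrite /= hidx // (proj2 (repP _)).
have idx_cls a b : cls a = cls b -> idx a = idx b by rewrite /idx => ->.
pose imul i j := idx (mul (rep i) (rep j)).
have imulE a b : S a -> S b -> imul (idx a) (idx b) = idx (mul a b).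
  by move=> Sa Sb; apply/idx_cls/clsM; apply: repK.
have imulA : associative imul.
  move=> i j l; rewrite -[i]idxK -[j]idxK -[l]idxK !imulE ?mulA //; exact: SM.
have imul1 : left_id (idx one) imul.
  by move=> i; rewrite -[i]idxK imulE // mul1.
have imulV : left_inverse (idx one) (fun i => idx (inv (rep i))) imul.
  move=> i; rewrite -[X in imul _ X]idxK imulE ?mulV //; exact: SV.
rewrite (prime_dvd_ord_group imulA imul1 imulV pr_p).
have iterE a m : S a -> S (iter m (mul a) one) /\
    iter m (imul (idx a)) (idx one) = idx (iter m (mul a) one).
  move=> Sa; elim: m => [|m [Sm IH]] //=; split; first exact: SM.
  by rewrite IH imulE.
split=> [[i i1 ip] | [a Sa [a1 ap]]].
  have [Sm E] := iterE (rep i) p (Srep i).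
  exists (rep i) => //; split=> [/idx_cls|]; first by rewrite idxK.
  by move: ip; rewrite -{1}[i]idxK E => e; rewrite -(repK _ Sm) e repK.
exists (idx a); first by move=> e; apply: a1; rewrite -(repK a Sa) e repK.
by rewrite (proj2 (iterE _ _ Sa)); apply: idx_cls.
Qed.

(** * Elements of prime order in PGL, in terms of matrices *)

Definition GL_of (k : fieldType) (n : nat) (A : 'M[k]_n) (uA : A \in unitmx) :
  GL k n := exist (fun M : 'M[k]_n => M \in unitmx) A uA.

Section PGLGroup.
Variables (k : fieldType) (n : nat).
Implicit Types A B : GL k n.+1.

Lemma GL_mul_subproof A B : val A *m val B \in unitmx.
Proof. by rewrite unitmx_mul (valP A) (valP B). Qed.

Definition GL_mul A B : GL k n.+1 := GL_of (GL_mul_subproof A B).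

Definition GL_one : GL k n.+1 := GL_of (unitmx1 k n.+1).

Lemma GL_inv_subproof A : invmx (val A) \in unitmx.
Proof. by rewrite unitmx_inv (valP A). Qed.

Definition GL_inv A : GL k n.+1 := GL_of (GL_inv_subproof A).

Lemma GL_mulA : associative GL_mul.
Proof. by move=> A B C; apply: val_inj; apply: mulmxA. Qed.

Lemma GL_mul1 : left_id GL_one GL_mul.
Proof. by move=> A; apply: val_inj; apply: mul1mx. Qed.

Lemma GL_mulV : left_inverse GL_one GL_inv GL_mul.
Proof. by move=> A; apply: val_inj; apply/mulVmx/(valP A). Qed.

Lemma val_iter_GL_mul A m : val (iter m (GL_mul A) GL_one) = val A ^+ m.
Proof. by elim: m => [|m IH] //=; rewrite IH exprS. Qed.

Lemma PGL_classP A B :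
  PGL_class A = PGL_class B <-> exists2 c, c != 0 & val B = c *: val A.
Proof. by split=> [/eqmodP/scalar_equivP|/scalar_equivP/eqmodP]. Qed.

Lemma PGL_class_one A : PGL_class A = PGL_class GL_one <-> is_scalar_mx (val A).
Proof.
split=> [/esym/PGL_classP[c _ ->] | /is_scalar_mxP[c cA]].
  by apply/is_scalar_mxP; exists c; rewrite scalemx1.
apply/esym/PGL_classP; exists c; last by rewrite scalemx1.
apply: contraTneq (valP A) => c0.
by rewrite cA c0 unitmxE det_scalar expr0n unitr0.
Qed.

(** A class in PGL is trivial exactly when its matrices are scalar, so an element of order [p] is
    represented by a nonscalar matrix with scalar [p]-th power. *)
Lemma prime_dvd_card_Paut (f : {mpoly k[n.+1]}) N p :
  prime p -> Paut f #= `I_N ->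
  (p %| N)%N <-> exists A : 'M[k]_n.+1,
    [/\ A \in unitmx, prop_to (subst_lin A f) f, ~~ is_scalar_mx A &
        is_scalar_mx (A ^+ p)].
Proof.
move=> pr_p cardN.
rewrite (prime_dvd_card_image GL_mulA GL_mul1 GL_mulV _ _ _ _ pr_p cardN).
- split=> [[A fA [A1 Ap]] | [A [uA fA A1 Ap]]].
    exists (val A); split; rewrite ?(valP A) //.
      by apply/negP => /PGL_class_one.
    by rewrite -val_iter_GL_mul; apply/PGL_class_one.
  exists (GL_of uA) => //; split.
    by move/PGL_class_one; apply/negP.
  by apply/PGL_class_one; rewrite val_iter_GL_mul.
- move=> A A' B B' /PGL_classP[a a0 EA] /PGL_classP[b b0 EB].
  apply/PGL_classP; exists (a * b); rewrite ?mulf_neq0 //=.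
  by rewrite EA EB -scalemxAr -scalemxAl scalerA mulrC.
- by exists 1; rewrite ?oner_neq0 // scale1r; apply: subst_lin1.
- move=> A [c c0 fA]; exists c^-1; first by rewrite invr_eq0.
  rewrite -[in RHS](subst_lin1 f) -(mulmxV (valP A)) -subst_lin_comp fA.
  by rewrite subst_linZ scalerA mulVf // scale1r.
- move=> A B [a a0 fA] [b b0 fB]; exists (a * b); first by rewrite mulf_neq0.
  by rewrite /= -subst_lin_comp fA subst_linZ fB scalerA.
Qed.

End PGLGroup.

(** Scaling the matrix by b multiplies the substituted form by b^d, and the field has d-th roots.
    Thus every element of [Paut f] lifts to a matrix that fixes [f] exactly. *)
Lemma subst_lin_normalize (k : closedFieldType) (n d : nat)
    (f : {mpoly k[n]}) (A : 'M[k]_n) :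
  (0 < d)%N -> f \is d.-homog -> prop_to (subst_lin A f) f ->
  exists2 b, b != 0 & subst_lin (b *: A) f = f.
Proof.
move=> d0 hf [c c0 fA]; have [b bc] := closed_field_root c^-1 d0.
exists b; last by rewrite (subst_lin_scale _ _ hf) fA scalerA bc mulVf // scale1r.
by apply: contra_neq c0 => b0; rewrite -[c]invrK -bc b0 expr0n gtn_eqF ?invr0.
Qed.

Lemma Paut_finite (k : closedFieldType) (n d : nat) (f : {mpoly k[n.+1]}) :
  [pchar k] =i pred0 -> (1 < d)%N -> f \is d.+1.-homog -> nonsingular f ->
  finite_set (Paut f).
Proof.
move=> ch d1 hf ns.
pose G : set 'M[k]_n.+1 := [set A | A \in unitmx /\ subst_lin A f = f].
have finG : finite_set G.
  apply: (finite_exponent_finite ch (fact_gt0 ((d ^ 2) ^ n.+1))).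
    move=> A B [uA fA] [uB fB]; split; first by rewrite unitmx_mul uA.
    by rewrite -mulmxE -subst_lin_comp fA.
  by move=> A [uA fA]; apply: stabilizer_exponent fA.
have finS : finite_set [set A : GL k n.+1 | G (val A)].
  by apply: (finite_preimage _ finG) => A B _ _; apply: val_inj.
apply: sub_finite_set (finite_image (@PGL_class k n.+1) finS).
move=> _ [A fA <-]; have [b b0 fbA] := subst_lin_normalize (ltn0Sn d) hf fA.
have uA := valP A.
have ubA : b *: val A \in unitmx by rewrite unitmxZ ?unitfE.
exists (GL_of ubA) => //=.
by apply/esym/PGL_classP; exists b.
Qed.

(** * Symmetries of order five *)

Lemma eigenvectors_unitmx (F : fieldType) (n : nat) (A V : 'M[F]_n) (d : 'I_n -> F) :
  injective d -> (forall i, row i V *m A = d i *: row i V) ->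
  (forall i, row i V != 0) -> V \in unitmx.
Proof.
move=> d_inj VA V0; rewrite -row_free_unit; apply: inj_row_free => u uV.
have Vi i : (u 0 i *: row i V <= eigenspace A (d i))%MS.
  by apply/scalemx_sub/eigenspaceP.
apply/rowP => i; rewrite mxE; apply/eqP.
have /mxdirect_sumsP/(_ i isT) dir :
    mxdirect (\sum_(i | predT i) eigenspace A (d i)).
  by apply: mxdirect_sum_eigenspace => a b _ _; apply: d_inj.
have : (u 0 i *: row i V <= (0 : 'M[F]_n))%MS.
  rewrite -dir sub_capmx Vi /=.
  have -> : u 0 i *: row i V = - \sum_(j | j != i) u 0 j *: row j V.
    apply/eqP; rewrite -subr_eq0 opprK; apply/eqP.
    by rewrite -[RHS]uV mulmx_sum_row [RHS](bigD1 i).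
  rewrite eqmx_opp; apply: summx_sub_sums => j _; exact: Vi.
by rewrite submx0 scaler_eq0 (negbTE (V0 i)) orbF.
Qed.

Lemma subst_lin_homog (k : fieldType) (n d : nat) (f : {mpoly k[n]}) (A : 'M[k]_n) :
  f \is d.-homog -> subst_lin A f \is d.-homog.
Proof.
move=> /dhomogP hf; rewrite [f]mpolyE subst_lin_sum big_seq.
apply: rpred_sum => m mf; rewrite subst_linZ; apply: rpredZ.
have <- : mdeg m = d by apply: hf.
rewrite /subst_lin comp_mpolyX mdegE.
apply: (big_ind2 (fun p e => p \is e.-homog)) => [|p e q e' hp hq|i _].
- exact: dhomog1.
- exact: dhomogM.
- rewrite tnth_mktuple; set h := \sum_j _.
  have /(dhomogMn (m i)) : h \is 1.-homog; last by rewrite mul1n.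
  by apply: rpred_sum => j _; apply: rpredZ; rewrite dhomogX /= mdeg1.
Qed.

Lemma nonsingular_subst_lin (k : fieldType) (n : nat) (f : {mpoly k[n]}) (A : 'M[k]_n) :
  A \in unitmx -> nonsingular f -> nonsingular (subst_lin A f).
Proof.
move=> uA ns; split=> [|v gv].
  apply: contraNneq (proj1 ns) => fA0.
  by rewrite -(subst_lin1 f) -(mulmxV uA) -subst_lin_comp fA0 /subst_lin comp_mpoly0.
pose w := \row_i v i.
have E : (fun i => w 0 i) =1 v by move=> i; rewrite mxE.
have g0 : gradient (subst_lin A f) w = 0.
  by apply/rowP => i; rewrite !mxE /row_eval (meval_eq _ E) gv.
rewrite gradient_subst_lin in g0.
have /(gradient_eq0 ns) wA : gradient f (w *m A^T) = 0.
  by rewrite -(mulmxK uA (gradient _ _)) g0 mul0mx.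
have : w = 0 by rewrite -(mulmxK (_ : A^T \in unitmx) w) ?unitmx_tr // wA mul0mx.
by move/rowP => w0 i; have := w0 i; rewrite !mxE.
Qed.

Lemma subst_lin_diagX (k : fieldType) (n : nat) (s : 'rV[k]_n) m :
  subst_lin (diag_mx s) 'X_[m] = (\prod_i s 0 i ^+ m i) *: 'X_[m].
Proof.
rewrite /subst_lin comp_mpolyX [in RHS]mpolyXE_id -scaler_prod.
apply: eq_bigr => i _; rewrite tnth_mktuple -exprZn (bigD1 i) //= mxE eqxx mulr1n.
rewrite big1 ?addr0 // => j ji.
by rewrite mxE eq_sym (negbTE ji) mulr0n scale0r.
Qed.

Lemma mcoeff_subst_lin_diag (k : fieldType) (n : nat) (s : 'rV[k]_n) f m :
  (subst_lin (diag_mx s) f)@_m = f@_m * \prod_i s 0 i ^+ m i.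
Proof.
rewrite {1}[f]mpolyE subst_lin_sum raddf_sum /=.
under eq_bigr => m' _ do
  rewrite subst_linZ subst_lin_diagX !mcoeffZ mcoeffX.
case: (boolP (m \in msupp f)) => hm.
  rewrite (bigD1_seq m) //= eqxx mulr1 [X in _ + X]big1 ?addr0 // => m' /negbTE ->.
  by rewrite !mulr0.
rewrite memN_msupp_eq0 // mul0r big_seq big1 // => m' hm'.
case: eqP => [e|_]; last by rewrite !mulr0.
by rewrite -e hm' in hm.
Qed.

(** At a coordinate point every monomial vanishes except the pure power. Applied to partial
    derivatives, this turns nonsingularity there into a condition on coefficients. *)
Lemma row_eval_delta (k : fieldType) (n d : nat) (f : {mpoly k[n]}) i :
  f \is d.-homog -> row_eval f (delta_mx 0 i) = f@_(U_(i) *+ d)%MM.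
Proof.
move=> /dhomogP hf; rewrite /row_eval mevalE.
have E m : m \in msupp f ->
    \prod_j (delta_mx 0 i : 'rV[k]_n) 0 j ^+ m j = (m == (U_(i) *+ d)%MM)%:R.
  move=> mf; have md : mdeg m = d by apply: hf.
  case: eqP => [-> | ne].
    rewrite big1 // => j _; rewrite !mxE mulmnE mnm1E eqxx /= eq_sym.
    by case: eqP => _; rewrite ?expr1n ?mul0n.
  have [j /andP[ji mj] | m0] := pickP (fun j => (j != i) && (m j != 0%N)).
    by rewrite (bigD1 j) //= mxE (negbTE ji) andbF expr0n (negbTE mj) mul0r.
  have mj0 j : j != i -> m j = 0%N.
    by move=> ji; have := m0 j; rewrite ji => /negbFE/eqP.
  case: ne; apply/mnmP => j; rewrite mulmnE mnm1E.
  have [<-|ij] := eqVneq i j; last by rewrite mj0 // eq_sym.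
  rewrite mul1n -md mdegE (bigD1 i) //= big1 ?addn0 // => l /mj0 //.
under eq_big_seq => m mf do rewrite (E m mf).
case: (boolP ((U_(i) *+ d)%MM \in msupp f)) => hm.
  rewrite (bigD1_seq _ hm) //= eqxx mulr1 [X in _ + X]big1 ?addr0 //.
  by move=> m' /negbTE ->; rewrite mulr0.
rewrite memN_msupp_eq0 // big_seq big1 // => m' hm'.
case: eqP => [e|_]; last by rewrite mulr0.
by rewrite -e hm' in hm.
Qed.

Lemma mpoly_sum_supp (R : nzRingType) (n : nat) (f : {mpoly R[n]}) (s : seq 'X_{1..n}) :
  uniq s -> {subset msupp f <= s} -> f = \sum_(m <- s) f@_m *: 'X_[m].
Proof.
move=> us sub; apply/mpolyP => m; rewrite raddf_sum /=.
under eq_bigr => m' _ do rewrite mcoeffZ mcoeffX.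
case: (boolP (m \in s)) => ms.
  rewrite (bigD1_seq m) //= eqxx mulr1 [X in _ + X]big1 ?addr0 //.
  by move=> m' /negbTE ->; rewrite mulr0.
rewrite memN_msupp_eq0; last by apply: contra ms; apply: sub.
rewrite big_seq big1 // => m' hm'; case: eqP => [e|_]; last by rewrite mulr0.
by rewrite -e hm' in ms.
Qed.

(** * Quartic monomials in four variables and their weights *)

Lemma big_ord4 (T : Type) (idx : T) (op : T -> T -> T) (F : 'I_4 -> T) :
  \big[op/idx]_(i < 4) F i = op (F 0) (op (F 1) (op (F 2) (op (F 3) idx))).
Proof.
rewrite !big_ord_recl big_ord0.
by do ![congr (op _ _) | congr (F _); apply: val_inj].
Qed.

Definition mono4 (a b c d : nat) : 'X_{1..4} :=
  [multinom nth 0%N [:: a; b; c; d] i | i < 4].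

Lemma mono4E (m : 'X_{1..4}) : m = mono4 (m 0) (m 1) (m 2) (m 3).
Proof.
apply/mnmP => -[[|[|[|[|i]]]] lti] //; rewrite mnmE /=;
  by congr (m _); apply: val_inj.
Qed.

Lemma mono4_eq a b c d a' b' c' d' :
  (mono4 a b c d == mono4 a' b' c' d') = ([:: a; b; c; d] == [:: a'; b'; c'; d']).
Proof.
apply/eqP/eqP => [/mnmP e | [-> -> -> ->] //].
by have := (e 0, e 1, e 2, e 3); rewrite /mono4 !mnmE /= => -[[[-> ->] ->] ->].
Qed.

Lemma mpolyX_mono4 (R : comNzRingType) a b c d :
  'X_[mono4 a b c d] = 'X_(0 : 'I_4) ^+ a * 'X_(1 : 'I_4) ^+ b *
    'X_(2 : 'I_4) ^+ c * 'X_(3 : 'I_4) ^+ d :> {mpoly R[4]}.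
Proof. by rewrite mpolyXE_id big_ord4 !mnmE /= mulr1 !mulrA. Qed.

(* The exponents of the eigenvalues [z, z^2, z^4, z^8 = z^3] on x, y, z, t. *)
Definition weight (m : 'X_{1..4}) : nat := (\sum_(i < 4) 2 ^ i * m i)%N.

Definition zeta_mx (k : fieldType) (z : k) : 'rV[k]_4 := \row_i z ^+ (2 ^ i).

Lemma subst_zeta_mxX (k : fieldType) (z : k) m :
  subst_lin (diag_mx (zeta_mx z)) 'X_[m] = z ^+ weight m *: 'X_[m].
Proof.
rewrite subst_lin_diagX -prodrXr; congr (_ *: _).
by apply: eq_bigr => i _; rewrite mxE exprM.
Qed.

(** The quartic monomials of weight divisible by 5, in the order of the terms of [quartic5]. *)
Definition monos5 : seq 'X_{1..4} :=
  [:: mono4 3 1 0 0; mono4 0 3 1 0; mono4 0 0 3 1; mono4 1 0 0 3;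
      mono4 2 0 2 0; mono4 0 2 0 2; mono4 1 1 1 1].

Lemma mem_monos5 m : mdeg m = 4%N -> (5 %| weight m)%N -> m \in monos5.
Proof.
rewrite {3}[m]mono4E mdegE /weight !big_ord4 /= !inE !mono4_eq.
move: (m 0) (m 1) (m 2) (m 3) => a b c d.
(* The last exponent is eliminated and the others are below 5, leaving a finite check. *)
rewrite !addnA !addn0 => abcd; have abc : (a + b + c < 5)%N by lia.
have {abcd} -> : d = (4 - a - b - c)%N by lia.
by move: a b c abc => [|[|[|[|[|a]]]]] [|[|[|[|[|b]]]]] [|[|[|[|[|c]]]]].
Qed.

Lemma quartic5E (k : fieldType) (lambda mu xi : k) :
  quartic5 lambda mu xi =
    'X_[mono4 3 1 0 0] + 'X_[mono4 0 3 1 0] + 'X_[mono4 0 0 3 1] +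
    'X_[mono4 1 0 0 3] + lambda *: 'X_[mono4 2 0 2 0] +
    mu *: 'X_[mono4 0 2 0 2] + xi *: 'X_[mono4 1 1 1 1].
Proof.
rewrite /quartic5 !mpolyX_mono4 !expr0 !expr1 !mulr1 !mul1r.
by rewrite [in RHS](mulrC _ ('X_(3 : 'I_4) ^+ 3)).
Qed.

Lemma quartic5_zeta (k : fieldType) (z lambda mu xi : k) :
  z ^+ 5 = 1 ->
  subst_lin (diag_mx (zeta_mx z)) (quartic5 lambda mu xi) = quartic5 lambda mu xi.
Proof.
move=> z5; have zX m : (5 %| weight m)%N -> z ^+ weight m = 1.
  by move=> /dvdnP[q ->]; rewrite mulnC exprM z5 expr1n.
rewrite quartic5E !subst_linD !subst_linZ !subst_zeta_mxX.
by rewrite !zX ?scale1r // /weight big_ord4 !mnmE.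
Qed.

(** A root of 1 + X + ... + X^4 works: it differs from 1 because 5 is nonzero in [k]. *)
Lemma exists_zeta5 (k : closedFieldType) :
  [pchar k] =i pred0 -> exists2 z : k, z ^+ 5 = 1 & z != 1.
Proof.
move=> /pcharf0P ch.
have /closed_rootP[z] : size (\poly_(i < 5) 1 : {poly k}) != 1%N.
  by rewrite size_poly_eq ?oner_neq0.
rewrite rootE horner_poly => /eqP; under eq_bigr do rewrite mul1r.
move=> sz; exists z.
  by apply/eqP; rewrite -subr_eq0 subrX1 sz mulr0.
apply: contra_eq_neq sz => ->; under eq_bigr do rewrite expr1n.
by rewrite sumr_const card_ord ch.
Qed.

Lemma order5_of_quartic5 (k : closedFieldType) (f : {mpoly k[4]}) lambda mu xi :
  [pchar k] =i pred0 -> proj_equiv f (quartic5 lambda mu xi) ->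
  exists A : 'M[k]_4,
    [/\ A \in unitmx, prop_to (subst_lin A f) f, ~~ is_scalar_mx A &
        is_scalar_mx (A ^+ 5)].
Proof.
move=> ch [T [c c0 fT]]; have [z z5 z1] := exists_zeta5 ch.
have uT := valP T; move: (val T) uT fT => {}T uT fT.
(* The diagonal symmetry of [quartic5] is carried back to [f] by conjugation with [T]. *)
pose D := diag_mx (zeta_mx z); pose A := T *m D *m invmx T.
have AT m : A ^+ m *m T = T *m D ^+ m.
  elim: m => [|m IH]; first by rewrite !expr0 mul1mx mulmx1.
  by rewrite !exprS -!mulmxE -mulmxA IH /A !mulmxA mulmxKV.
have DX m : D ^+ m = diag_mx (\row_i zeta_mx z 0 i ^+ m).
  elim: m => [|m IH]; first by apply/matrixP => i j; rewrite expr0 !mxE expr0.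
  rewrite exprSr IH -mulmxE mulmx_diag; congr diag_mx.
  by apply/rowP => i; rewrite !mxE exprSr.
have z0 : z != 0.
  by apply: contra_eq_neq z5 => ->; rewrite expr0n eq_sym oner_eq0.
have D5 : D ^+ 5 = 1.
  by apply/matrixP => i j; rewrite DX !mxE -exprM mulnC exprM z5 expr1n.
have A5 : A ^+ 5 = 1.
  by rewrite -[A ^+ 5](mulmxK uT) AT D5 mulmx1 mulmxV.
exists A; split.
- by rewrite -[_ \in _]/(A \is a GRing.unit) -(@unitrX_pos _ A 5) // A5 unitr1.
- exists 1; rewrite ?oner_neq0 // scale1r /A.
  rewrite -mulmxA -!subst_lin_comp fT subst_linZ quartic5_zeta // -fT.
  by rewrite subst_lin_comp mulmxV // subst_lin1.
- apply/negP => /is_scalar_mxP[a Aa].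
  have Da : D = a%:M.
    apply: (row_full_inj (_ : row_full T)); first by rewrite row_full_unit.
    by rewrite /= -[D]expr1 -AT expr1 Aa scalar_mxC.
  have D0 : z = a by have := congr1 (fun M : 'M_4 => M 0 0) Da; rewrite !mxE.
  have D1 : z ^+ 2 = a by have := congr1 (fun M : 'M_4 => M 1 1) Da; rewrite !mxE.
  by move: z1; rewrite -(inj_eq (mulfI z0)) mulr1 -expr2 D1 -D0 eqxx.
- by rewrite A5; apply: scalar_mx_is_scalar.
Qed.

(** * From a symmetry of order five to the normal form *)

Lemma normalize_order5 (k : closedFieldType) (f : {mpoly k[4]}) (A : 'M[k]_4) :
  f \is 4.-homog -> f != 0 -> A \in unitmx -> prop_to (subst_lin A f) f ->
  ~~ is_scalar_mx A -> is_scalar_mx (A ^+ 5) ->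
  exists B : 'M[k]_4, [/\ B \in unitmx, subst_lin B f = f, B != 1 & B ^+ 5 = 1].
Proof.
move=> hf f0 uA fA nA A5.
have [b b0 fbA] := subst_lin_normalize (isT : 0 < 4)%N hf fA.
have /is_scalar_mxP[c bA5] : is_scalar_mx ((b *: A) ^+ 5).
  case/is_scalar_mxP: A5 => c Ac.
  by rewrite exprZn Ac scale_scalar_mx scalar_mx_is_scalar.
have fX m : subst_lin ((b *: A) ^+ m) f = f.
  elim: m => [|m IH]; first exact: subst_lin1.
  by rewrite exprS -mulmxE -subst_lin_comp fbA.
(* The scalar [c] fixes the nonzero quartic [f]. *)
have c4 : c ^+ 4 = 1.
  have /eqP := fX 5; rewrite bA5 -scalemx1 (subst_lin_scale _ _ hf) subst_lin1.
  rewrite -subr_eq0 -{2}[f]scale1r -scalerBl scaler_eq0 (negbTE f0) orbF subr_eq0.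
  by move/eqP.
have c0 : c != 0.
  by apply: contra_eq_neq c4 => ->; rewrite expr0n eq_sym oner_eq0.
have c3b : c ^+ 3 * b != 0 by rewrite mulf_neq0 ?expf_neq0.
(* A factor u must satisfy u^4 = 1, to keep fixing [f], and u^5 c = 1, to reach order five; hence u
   = c^-1 = c^3. *)
exists (c ^+ 3 *: (b *: A)); split.
- by rewrite scalerA unitmxZ ?unitfE.
- by rewrite (subst_lin_scale _ _ hf) fbA -exprM mulnC exprM c4 expr1n scale1r.
- apply: contraNneq nA => A1; apply/is_scalar_mxP; exists (c ^+ 3 * b)^-1.
  by rewrite -scalemx1 -[1%:M]/(1 : 'M_4) -A1 (scalerA (c ^+ 3)) scalerA mulVf // scale1r.
- rewrite exprZn bA5 scale_scalar_mx -exprM -exprSr.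
  by rewrite (_ : 16 = 4 * 4)%N // exprM c4 expr1n.
Qed.

(** Otherwise [A] would be unipotent, and a unipotent symmetry of [f] is the identity. *)
Lemma exists_eigenvalue_neq1 (k : closedFieldType) (n d : nat)
    (f : {mpoly k[n.+1]}) (A : 'M[k]_n.+1) :
  [pchar k] =i pred0 -> (1 < d)%N -> f \is d.+1.-homog -> nonsingular f ->
  A \in unitmx -> subst_lin A f = f -> A != 1 ->
  exists2 a, eigenvalue A a & a != 1.
Proof.
move=> ch d1 hf ns uA fA A1; apply: contrapT => nE; case/eqP: A1.
apply: (unipotent_stabilizer uA ch d1 hf ns fA (e := n.+1)).
rewrite -[A]expr1; apply: nilpotent_of_eigenvalues => a Ea; rewrite expr1.
by apply/eqP; apply: contrapT => /negP a1; apply: nE; exists a.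
Qed.

(* The eigenvalues are stable under [a |-> a^-3 = a^2], so they are the four
   primitive fifth roots of unity. *)
Lemma diagonalize_order5 (k : closedFieldType) (f : {mpoly k[4]}) (A : 'M[k]_4) :
  [pchar k] =i pred0 -> f \is 4.-homog -> nonsingular f -> A \in unitmx ->
  subst_lin A f = f -> A != 1 -> A ^+ 5 = 1 ->
  exists (z : k) (T : 'M[k]_4), [/\ 5.-primitive_root z, T \in unitmx &
    subst_lin (diag_mx (zeta_mx z)) (subst_lin T f) = subst_lin T f].
Proof.
move=> ch hf ns uA fA A1 A5.
have [z Ez z1] := exists_eigenvalue_neq1 ch (isT : 1 < 3)%N hf ns uA fA A1.
have z5 := eigenvalue_exp A5 Ez.
have prim_z : 5.-primitive_root z.
  have [m pm] := prim_order_exists (isT : 0 < 5)%N z5.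
  case/(proj2 (elimT primeP (isT : prime 5)))/pred2P => m_eq; rewrite m_eq in pm => //.
  by case/eqP: z1; rewrite -[z]expr1 (prim_expr_order pm).
have Ezi i : eigenvalue A (z ^+ (2 ^ i)).
  elim: i => [|i IH]; first by rewrite expn0 expr1.
  set a := z ^+ (2 ^ i) in IH; have a5 := eigenvalue_exp A5 IH.
  have a0 := unit_eigenvalue_neq0 uA IH.
  have fA1 : subst_lin A f = 1 *: f by rewrite scale1r.
  have := eigenvalue_gradient hf ns fA1 a0 IH.
  suff -> : 1 / a ^+ 3 = a ^+ 2 by rewrite expnSr exprM.
  apply: (mulIf (expf_neq0 3 a0)).
  by rewrite divfK; [rewrite -exprD a5 | apply: expf_neq0 a0].
have /choice[v vP] (i : 'I_4) :
    exists v : 'rV[k]_4, v *m A^T = zeta_mx z 0 i *: v /\ v != 0.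
  have := Ezi i; rewrite -eigenvalue_trmx => /eigenvalueP[v vA v0].
  by exists v; rewrite mxE.
pose V := \matrix_i v i.
have rowVA i : row i V *m A^T = zeta_mx z 0 i *: row i V.
  by rewrite rowK (proj1 (vP i)).
have uV : V \in unitmx.
  apply: (eigenvectors_unitmx (d := fun i => zeta_mx z 0 i) _ rowVA) => [i j|i]; last first.
    by rewrite rowK (proj2 (vP i)).
  (* The exponents 1, 2, 4, 8 are distinct modulo 5. *)
  rewrite !mxE => /eqP; rewrite (eq_prim_root_expr prim_z).
  by case: i j => [[|[|[|[|i]]]] hi] // [[|[|[|[|j]]]] hj] // _; apply: val_inj.
(* The rows of [V] are eigenvectors of [A^T], so the columns of [V^T] are eigenvectors of [A], and A
   V^T = V^T D with D the diagonal matrix. *)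
exists z, V^T; split; [exact: prim_z | by rewrite unitmx_tr |].
have VA : V *m A^T = diag_mx (zeta_mx z) *m V.
  by apply/row_matrixP => i; rewrite row_mul rowVA mul_diag_mx;
    apply/rowP => j; rewrite !mxE.
rewrite subst_lin_comp -[diag_mx _]trmxK -trmx_mul tr_diag_mx -VA trmx_mul trmxK.
by rewrite -subst_lin_comp fA.
Qed.

(** The partial derivative in direction j at the i-th coordinate point is a multiple of the
    coefficient of x_i^3 x_j. Its weight 3 * 2^i + 2^j is divisible by 5 only for j = i + 1 modulo
    4, so if that coefficient also vanished the point would be singular. *)
Lemma leading_coef_neq0 (k : fieldType) (g : {mpoly k[4]}) i :
  g \is 4.-homog -> nonsingular g ->
  {in msupp g, forall m, (5 %| weight m)%N} ->
  g@_(U_(i) *+ 3 + U_(ordS i))%MM != 0.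
Proof.
move=> hg ns wg; apply/negP => /eqP g0.
have : (delta_mx 0 i : 'rV[k]_4) = 0.
  apply: (gradient_eq0 ns); apply/rowP => j; rewrite !mxE.
  rewrite (row_eval_delta _ (dhomog_mderiv _ hg)) mcoeff_mderiv.
  have [-> | ji] := eqVneq j (ordS i); first by rewrite g0 mul0rn.
  rewrite memN_msupp_eq0 ?mul0rn //; apply: contra ji => /wg.
  rewrite /weight big_ord4 !mnmDE !mnm1E {g0 ns hg wg}.
  by case: i j => [[|[|[|[|i]]]] hi] // [[|[|[|[|j]]]] hj].
by move/rowP/(_ i)/eqP; rewrite !mxE !eqxx oner_eq0.
Qed.

Lemma cyclic_scaling (k : closedFieldType) (a b c d : k) :
  a != 0 -> b != 0 -> c != 0 -> d != 0 ->
  exists p q r t : k, [/\ p ^+ 3 * q * a = 1, q ^+ 3 * r * b = 1,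
    r ^+ 3 * t * c = 1 & t ^+ 3 * p * d = 1].
Proof.
move=> a0 b0 c0 d0.
(* The first three equations give q, r, t in turn as monomials in p; the fourth then prescribes
   p^80, where 80 = 3^4 - 1. *)
have [p pE] := closed_field_root (d * c ^- 3 * b ^+ 9 * a ^- 27) (isT : 0 < 80)%N.
have p0 : p != 0.
  have : p ^+ 80 != 0 by rewrite pE !mulf_neq0 ?invr_eq0 ?expf_neq0.
  by rewrite expf_eq0.
(* Eliminating [d] turns the four equations into identities of rational functions. *)
have -> : d = p ^+ 80 * c ^+ 3 * b ^- 9 * a ^+ 27.
  by rewrite pE; field; rewrite c0 a0 b0.
exists p, (a^-1 * p ^- 3), (b^-1 * a ^+ 3 * p ^+ 9),
  (c^-1 * b ^+ 3 * a ^- 9 * p ^- 27).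
by split; field; rewrite ?a0 ?b0 ?c0 ?p0.
Qed.

Lemma quartic5_of_diag (k : closedFieldType) (g : {mpoly k[4]}) :
  g \is 4.-homog -> nonsingular g ->
  {in msupp g, forall m, (5 %| weight m)%N} ->
  exists (s : 'rV[k]_4) (lambda mu xi : k),
    diag_mx s \in unitmx /\ subst_lin (diag_mx s) g = quartic5 lambda mu xi.
Proof.
move=> hg ns wg.
have mono_lead (i : 'I_4) a b c d :
    (U_(i) *+ 3 + U_(ordS i))%MM = mono4 a b c d -> g@_(mono4 a b c d) != 0.
  by move=> <-; apply: leading_coef_neq0.
have c0 : g@_(mono4 3 1 0 0) != 0.
  by apply: (mono_lead 0); rewrite [LHS]mono4E !mnmDE !mnm1E.
have c1 : g@_(mono4 0 3 1 0) != 0.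
  by apply: (mono_lead 1); rewrite [LHS]mono4E !mnmDE !mnm1E.
have c2 : g@_(mono4 0 0 3 1) != 0.
  by apply: (mono_lead 2); rewrite [LHS]mono4E !mnmDE !mnm1E.
have c3 : g@_(mono4 1 0 0 3) != 0.
  by apply: (mono_lead 3); rewrite [LHS]mono4E !mnmDE !mnm1E.
have [p [q [r [t [E0 E1 E2 E3]]]]] := cyclic_scaling c0 c1 c2 c3.
pose s : 'rV[k]_4 := \row_i nth 0 [:: p; q; r; t] i.
pose h := subst_lin (diag_mx s) g.
have hE m : h@_m = g@_m * (p ^+ m 0 * q ^+ m 1 * r ^+ m 2 * t ^+ m 3).
  by rewrite mcoeff_subst_lin_diag big_ord4 !mxE /= mulr1 !mulrA.
(* The scaling is used up on the four cyclic monomials; the parameters are whatever coefficients the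
   other three have acquired. *)
exists s, h@_(mono4 2 0 2 0), h@_(mono4 0 2 0 2), h@_(mono4 1 1 1 1); split.
  rewrite unitmxE det_diag big_ord4 !mxE /= mulr1 unitfE.
  have neq0 (x y z : k) : x ^+ 3 * y * z = 1 -> x != 0.
    by apply: contra_eq_neq => ->; rewrite expr0n /= !mul0r eq_sym oner_eq0.
  by rewrite !mulf_neq0 ?(neq0 _ _ _ E0) ?(neq0 _ _ _ E1) ?(neq0 _ _ _ E2)
             ?(neq0 _ _ _ E3).
rewrite -/h [LHS](mpoly_sum_supp (s := monos5)).
- rewrite /monos5 !big_cons big_nil addr0 quartic5E !addrA.
  have -> : h@_(mono4 3 1 0 0) = 1.
    by rewrite hE !mnmE /= -E0; ring.
  have -> : h@_(mono4 0 3 1 0) = 1.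
    by rewrite hE !mnmE /= -E1; ring.
  have -> : h@_(mono4 0 0 3 1) = 1.
    by rewrite hE !mnmE /= -E2; ring.
  have -> : h@_(mono4 1 0 0 3) = 1.
    by rewrite hE !mnmE /= -E3; ring.
  by rewrite !scale1r.
- by rewrite /= !inE !mono4_eq.
- move=> m; rewrite mcoeff_msupp hE => hm.
  have mg : m \in msupp g.
    by rewrite mcoeff_msupp; apply: contraNneq hm => ->; rewrite mul0r.
  by apply: mem_monos5; [apply: (dhomogP _ _ _ hg) | apply: wg].
Qed.

Lemma quartic5_of_order5 (k : closedFieldType) (f : {mpoly k[4]}) (A : 'M[k]_4) :
  [pchar k] =i pred0 -> f \is 4.-homog -> nonsingular f -> A \in unitmx ->
  prop_to (subst_lin A f) f -> ~~ is_scalar_mx A -> is_scalar_mx (A ^+ 5) ->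
  exists lambda mu xi : k, proj_equiv f (quartic5 lambda mu xi).
Proof.
move=> ch hf ns uA fA nA A5.
have [B [uB fB B1 B5]] := normalize_order5 hf (proj1 ns) uA fA nA A5.
have [z [T [pz uT gD]]] := diagonalize_order5 ch hf ns uB fB B1 B5.
set g := subst_lin T f in gD.
(* Invariance multiplies the coefficient at [m] by z^(weight m), so a nonzero coefficient forces
   this power to be 1. *)
have wg : {in msupp g, forall m, (5 %| weight m)%N}.
  move=> m; rewrite mcoeff_msupp => gm; have := congr1 (mcoeff m) gD.
  rewrite mcoeff_subst_lin_diag -[RHS]mulr1 => /(mulfI gm).
  under eq_bigr => i _ do rewrite mxE -exprM.
  by rewrite prodrXr => /eqP; rewrite -(prim_order_dvd pz).
have [s [lambda [mu [xi [us gs]]]]] :=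
  quartic5_of_diag (subst_lin_homog T hf) (nonsingular_subst_lin uT ns) wg.
have uTs : T *m diag_mx s \in unitmx by rewrite unitmx_mul uT.
exists lambda, mu, xi, (GL_of uTs); exists 1; rewrite ?oner_neq0 // scale1r /=.
by rewrite -subst_lin_comp.
Qed.

Theorem theorem3p1 (k : closedFieldType) (hchar : [pchar k] =i pred0)
    (f : {mpoly k[4]}) (hdeg : f \is 4.-homog) (hns : nonsingular f) :
  (exists2 N : nat, Paut f #= `I_N & (5 %| N)%N) <->
  (exists lambda mu xi : k, proj_equiv f (quartic5 lambda mu xi)).
Proof.
have pr5 : prime 5 by [].
split=> [[N cardN] | [lambda [mu [xi equiv]]]].
  rewrite (prime_dvd_card_Paut pr5 cardN) => -[A [uA fA nA A5]].
  exact: quartic5_of_order5 uA fA nA A5.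
(* Here the cardinal must be produced, so finiteness of [Paut f] comes first; in the other direction
   it was given. *)
have /finite_setP[N cardN] := Paut_finite hchar (isT : 1 < 3)%N hdeg hns.
exists N; first exact: cardN.
apply/(prime_dvd_card_Paut pr5 cardN).
exact: order5_of_quartic5 hchar equiv.
Qed.
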